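(* If $X$ is a (norm) countably generated $C^*$-module over a $\Sigma^*$-algebra $\mathfrak{B}\subseteq B(\mathcal{H})$, then the $\Sigma^*$-module completion $\mathscr{B}(X)$ is, up to unitary isomorphism, the unique $\Sigma^*$-module over $\mathfrak{B}$ containing $X$ as a WOT$_{\mathfrak{B}}$ sequentially dense submodule.
   Context: WOT is the weak operator topology. A (concrete) $\Sigma^*$-algebra is a nondegenerate $C^*$-algebra $\mathfrak{B} \subseteq B(\mathcal{H})$ such that the limit in $B(\mathcal{H})$ of every WOT-convergent sequence in $\mathfrak{B}$ lies in $\mathfrak{B}$. A $C^*$-module over a $C^*$-algebra $A$ means a right Hilbert $C^*$-module, with $A$-valued inner product $\langle\cdot|\cdot\rangle$ linear and $A$-linear in the second variable and conjugate-linear in the first. $X\otimes_{\mathfrak{B}}\mathcal{H}$ is the Hilbert space completion of the algebraic module tensor product $X\odot_{\mathfrak{B}}\mathcal{H}$ for the inner product determined by $\langle x\otimes\zeta,y\otimes\eta\rangle=\langle\zeta,\langle x|y\rangle\eta\rangle$, and $X$ is canonically embedded in $B(\mathcal{H},X\otimes_{\mathfrak{B}}\mathcal{H})$ by $x(\zeta)=x\otimes\zeta$. A $C^*$-module $\mathfrak{X}$ over $\mathfrak{B}$ is a $\Sigma^*$-module if its canonical image in $B(\mathcal{H},\mathfrak{X}\otimes_{\mathfrak{B}}\mathcal{H})$ is WOT sequentially closed. $\mathscr{B}(X)$ is the smallest WOT sequentially closed subset of $B(\mathcal{H},X\otimes_{\mathfrak{B}}\mathcal{H})$ containing $X$. It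 is a $\Sigma^*$-module over $\mathfrak{B}$ with right action by composition of operators and inner product $\langle S|T\rangle=S^*T\in\mathfrak{B}$. For a sequence $(x_n)$ and $x$ in a $C^*$-module $\mathfrak{X}$ over $\mathfrak{B}$, $x_n\to x$ in WOT$_{\mathfrak{B}}$ means $\langle x_n|y\rangle\to\langle x|y\rangle$ WOT in $B(\mathcal{H})$ for all $y\in\mathfrak{X}$. A submodule $X$ of $\mathfrak{X}$ (with inner product the restriction of that of $\mathfrak{X}$) is WOT$_{\mathfrak{B}}$ sequentially dense if $\mathfrak{X}$ is the only subset of itself that contains $X$ and is closed under limits of WOT$_{\mathfrak{B}}$-convergent sequences. $X$ is (norm) countably generated if there is a countable subset of $X$ whose $\mathfrak{B}$-linear span is norm dense in $X$. A unitary isomorphism of $C^*$-modules is a surjective module map preserving the inner products. *)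

(* Defs.v *)
From HB Require Import structures.
From mathcomp Require Import all_boot all_order all_algebra.
From mathcomp Require Import complex.
From mathcomp Require Import all_classical all_reals all_analysis.

Set Implicit Arguments.
Unset Strict Implicit.
Unset Printing Implicit Defensive.

Import Order.TTheory GRing.Theory Num.Theory.
Import numFieldNormedType.Exports.

Local Open Scope classical_set_scope.
Local Open Scope ring_scope.

Record hilbertType (R : realType) := Hilbert {
  hilbert_sort :> completeNormedModType R[i];
  hdot : {dot hilbert_sort for Num.conj};
  hdotE : forall u : hilbert_sort, hdot u u = `|u| ^+ 2
}.

(* The library's [{dot _ for _}] is linear in its first argument; [hip] is the
   same inner product, linear in the second argument. *)
Definition hip (R : realType) (H : hilbertType R) (u v : H) : R[i] := hdot H v u.

Definition lspan (C : numFieldType) (V : lmodType C) (G : set V) : set V :=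
  [set v | exists (n : nat) (c : 'I_n -> C) (g : 'I_n -> V),
     (forall i, G (g i)) /\ v = \sum_(i < n) c i *: g i].

Section BoundedOperators.
Variables (C : numFieldType) (V W : normedModType C).

Definition bounded_op : {pred V -> W} :=
  [pred f : V -> W | `[< linear f /\ continuous f >]].

Fact bounded_op_submod_closed : submod_closed bounded_op.
Proof.
split=> [|a f g /asboolP[lf cf] /asboolP[lg cg]]; apply/asboolP; split.
- by move=> a x y; rewrite /= scaler0 addr0.
- exact: cst_continuous.
- move=> b x y; rewrite !fctE /= lf lg !scalerDr !scalerA (mulrC a b).
  by rewrite -!scalerA addrACA.
- move=> x; apply: (@continuousD _ _ _ (a *: f) g); last exact: cg.
by apply: (@continuousZ _ _ _ (cst a) f); [exact: cst_continuous|exact: cf].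
Qed.
HB.instance Definition _ :=
  GRing.isSubmodClosed.Build C (V -> W) bounded_op bounded_op_submod_closed.

Record bop := Bop { bop_fun :> V -> W ; _ : bop_fun \in bounded_op }.

HB.instance Definition _ := [isSub for bop_fun].
HB.instance Definition _ := [Choice of bop by <:].
HB.instance Definition _ := [SubChoice_isSubLmodule of bop by <:].

Lemma bop_linear (T : bop) : linear T.
Proof. by case: T => f /= /asboolP[]. Qed.

Lemma bop_continuous (T : bop) : continuous T.
Proof. by case: T => f /= /asboolP[]. Qed.

HB.instance Definition _ (T : bop) :=
  GRing.isLinear.Build C V W _ T (bop_linear T).

End BoundedOperators.

Section OperatorOperations.
Variable R : realType.
Implicit Types H K L : hilbertType R.

Fact bcomp_subproof (C : numFieldType) (U V W : normedModType C)
  (S : bop V W) (T : bop U V) : (S \o T) \in @bounded_op C U W.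
Proof.
apply/asboolP; split.
  by move=> a x y; rewrite /= bop_linear bop_linear.
by move=> x; apply: continuous_comp; exact: bop_continuous.
Qed.

Definition bcomp (C : numFieldType) (U V W : normedModType C)
  (S : bop V W) (T : bop U V) : bop U W := Bop (bcomp_subproof S T).

Definition opnorm H K (T : bop H K) : R :=
  sup [set complex.Re `|T z| | z in [set z : H | `|z| <= 1]].

(* The Hilbert space adjoint T^*: the default value 0 is never used, since
   every bounded operator has a (unique) adjoint. *)
Definition adj H K (T : bop H K) : bop K H :=
  xget 0 [set S : bop K H | forall (z : H) (w : K), hip (S w) z = hip w (T z)].

Definition wot_cvg H K (u : nat -> bop H K) (T : bop H K) : Prop :=
  forall (z : H) (w : K),
    (fun n => hip (u n z) w : R[i]^o) @ \oo --> (hip (T z) w : R[i]^o).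

Definition wot_seq_closed H K (D : set (bop H K)) : Prop :=
  forall (u : nat -> bop H K) (T : bop H K),
    (forall n, D (u n)) -> wot_cvg u T -> D T.

End OperatorOperations.

Section Algebras.
Variables (R : realType) (H : hilbertType R).

Record is_cstar_algebra (B : set (bop H H)) : Prop := IsCstarAlgebra {
  csa_0 : B 0;
  csa_lin : forall (a : R[i]) (b c : bop H H), B b -> B c -> B (a *: b + c);
  csa_mul : forall b c : bop H H, B b -> B c -> B (bcomp b c);
  csa_adj : forall b : bop H H, B b -> B (adj b);
  csa_closed : forall (u : nat -> bop H H) (b : bop H H), (forall n, B (u n)) ->
    (fun n => opnorm (u n - b)) @ \oo --> (0 : R) -> B b;
  csa_nondegenerate :
    closure (lspan [set (b : bop H H) z | b in B & z in [set: H]]) = [set: H]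
}.

Definition is_sigma_algebra (B : set (bop H H)) : Prop :=
  is_cstar_algebra B /\ wot_seq_closed B.

End Algebras.

(* The data of a right module with operator-valued inner product over an
   algebra B of operators on H.  The action [pact x b] is written as a total
   function of the operator b, but it is meaningful only for b in B: everything
   below constrains, or makes use of, its values only for such b. *)
Record premod (R : realType) (H : hilbertType R) := PreMod {
  premod_sort :> lmodType R[i];
  pact : premod_sort -> bop H H -> premod_sort;
  pip : premod_sort -> premod_sort -> bop H H
}.

Section Modules.
Variables (R : realType) (H : hilbertType R) (B : set (bop H H)).
Implicit Types X Y : premod H.

Definition pnorm X (x : X) : R := Num.sqrt (opnorm (pip x x)).

Record is_cstar_module X : Prop := IsCstarModule {
  csm_actDl : forall (x y : X) (b : bop H H), B b ->
    pact (x + y) b = pact x b + pact y b;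
  csm_actDr : forall (x : X) (b c : bop H H), B b -> B c ->
    pact x (b + c) = pact x b + pact x c;
  csm_actM : forall (x : X) (b c : bop H H), B b -> B c ->
    pact x (bcomp b c) = pact (pact x b) c;
  csm_actZl : forall (a : R[i]) (x : X) (b : bop H H), B b ->
    pact (a *: x) b = a *: pact x b;
  csm_actZr : forall (a : R[i]) (x : X) (b : bop H H), B b ->
    pact x (a *: b) = a *: pact x b;
  csm_ip : forall x y : X, B (pip x y);
  csm_ip_lin : forall (a : R[i]) (x y z : X),
    pip x (a *: y + z) = a *: pip x y + pip x z;
  csm_ip_act : forall (x y : X) (b : bop H H), B b ->
    pip x (pact y b) = bcomp (pip x y) b;
  csm_ip_adj : forall x y : X, pip y x = adj (pip x y);
  csm_ip_ge0 : forall (x : X) (z : H), 0 <= hip z (pip x x z);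
  csm_ip_def : forall x : X, pip x x = 0 -> x = 0;
  csm_complete : forall u : nat -> X,
    (forall e : R, 0 < e -> exists N : nat, forall m n : nat,
       (N <= m)%N -> (N <= n)%N -> pnorm (u m - u n) < e) ->
    exists x : X, (fun n => pnorm (u n - x)) @ \oo --> (0 : R)
}.

Definition countably_generated X : Prop :=
  exists2 G : set X, countable G &
    forall (x : X) (e : R), 0 < e ->
      exists2 y, lspan [set pact g b | g in G & b in B] y & pnorm (x - y) < e.

(* A Hilbert space completion K of the algebraic module tensor product of X and
   H over B, presented by the operators x : z |-> x (x) z from H to K: that is, a
   bilinear B-balanced map from X x H to K which carries the inner product of
   simple tensors and whose range spans a dense subspace. Demanding that each
   z |-> x (x) z be bounded is no restriction, for |x (x) z| <= |x| |z| follows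
   from the inner product formula. Such a K is unique up to unitary
   isomorphism. *)
Record itensor X := ITensor {
  itensor_space : hilbertType R;
  itensor_map :> {linear X -> bop H itensor_space};
  itensor_balanced : forall (x : X) (b : bop H H) (z : H), B b ->
    itensor_map (pact x b) z = itensor_map x (b z);
  itensor_ip : forall (x y : X) (z w : H),
    hip (itensor_map x z) (itensor_map y w) = hip z (pip x y w);
  itensor_dense :
    closure (lspan [set itensor_map x z | x in [set: X] & z in [set: H]])
      = [set: itensor_space]
}.

Definition is_sigma_module X : Prop :=
  is_cstar_module X /\ exists E : itensor X, wot_seq_closed (range E).

Definition is_isometric_module_map X Y (f : X -> Y) : Prop :=
  [/\ linear f,
      forall (x : X) (b : bop H H), B b -> f (pact x b) = pact (f x) b &
      forall x y : X, pip (f x) (f y) = pip x y].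

Definition is_unitary_iso X Y (U : X -> Y) : Prop :=
  is_isometric_module_map U /\ range U = [set: Y].

Definition wotB_cvg X (u : nat -> X) (x : X) : Prop :=
  forall y : X, wot_cvg (fun n => pip (u n) y) (pip x y).

Definition wotB_seq_closed X (D : set X) : Prop :=
  forall (u : nat -> X) (x : X), (forall n, D (u n)) -> wotB_cvg u x -> D x.

Definition wotB_seq_dense X (S : set X) : Prop :=
  forall D : set X, S `<=` D -> wotB_seq_closed D -> D = [set: X].

(* Y is a Sigma*-module over B containing (via i) X as a WOT_B sequentially
   dense submodule. *)
Definition is_sigma_extension X Y (i : X -> Y) : Prop :=
  [/\ is_sigma_module Y, is_isometric_module_map i & wotB_seq_dense (range i)].

End Modules.

Section Completion.
Variables (R : realType) (H : hilbertType R) (B : set (bop H H)).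
Variables (X : premod H) (E : itensor B X).
Local Notation K := (itensor_space E).

Definition completion_set : set (bop H K) :=
  smallest (@wot_seq_closed R H K) (range E).

Lemma sub_completion_set : range E `<=` completion_set.
Proof. exact: sub_smallest. Qed.

Lemma completion_set_closed : wot_seq_closed completion_set.
Proof.
by move=> u T uD uT D [Dc ED]; apply: (Dc u) => // n; apply: uD.
Qed.

Fact wot_cvg_cst (L L' : hilbertType R) (T : bop L L') :
  wot_cvg (fun=> T) T.
Proof. by move=> z w; apply: (@cvg_cst R[i]^o). Qed.

Fact cvg_lin (C : numFieldType) (a : C) (u v : nat -> C^o) (k l : C^o) :
  u @ \oo --> k -> v @ \oo --> l ->
  (fun n => a * u n + v n : C^o) @ \oo --> (a * k + l : C^o).
Proof. by move=> uk vl; apply: cvgD => //; apply: (@cvgZl_tmp C C^o). Qed.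

Fact wot_cvg_lin (a : R[i]) (u v : nat -> bop H K) (S T : bop H K) :
  wot_cvg u S -> wot_cvg v T -> wot_cvg (fun n => a *: u n + v n) (a *: S + T).
Proof.
move=> uS vT z w.
rewrite (_ : (fun n => _) =
    (fun n => Num.conj a * hip (u n z) w + hip (v n z) w)); last first.
  by apply/funext => n; rewrite /hip /= linearD linearZ.
rewrite (_ : hip _ w = Num.conj a * hip (S z) w + hip (T z) w); last first.
  by rewrite /hip /= linearD linearZ.
exact: (@cvg_lin R[i] (Num.conj a) _ _ _ _ (uS z w) (vT z w)).
Qed.

Definition completion_pred : {pred bop H K} := [pred T | T \in completion_set].

Fact completion_submod_closed : submod_closed completion_pred.
Proof.
have rangeP (T : bop H K) (a : R[i]) (S : bop H K) :
    range E T -> range E S -> range E (a *: S + T).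
  by move=> [x _ <-] [y _ <-]; exists (a *: y + x) => //; rewrite linearP.
have clD (a : R[i]) (S : bop H K) :
    wot_seq_closed [set T | completion_set (a *: S + T)].
  move=> u T uD uT; apply: (@completion_set_closed (fun n => a *: S + u n)).
    exact: uD.
  by apply: wot_cvg_lin; [exact: wot_cvg_cst|exact: uT].
have clS (a : R[i]) (T : bop H K) :
    wot_seq_closed [set S | completion_set (a *: S + T)].
  move=> u S uD uS; apply: (@completion_set_closed (fun n => a *: u n + T)).
    exact: uD.
  by apply: wot_cvg_lin; [exact: uS|exact: wot_cvg_cst].
split=> [|a S T].
  by rewrite inE; apply: sub_completion_set; exists 0 => //; rewrite linear0.
rewrite !inE => SD TD.
apply: (SD [set S | completion_set (a *: S + T)]); split; first exact: clS.
move=> {SD}S SE /=.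
apply: (TD [set T | completion_set (a *: S + T)]); split; first exact: clD.
by move=> {TD}T TE /=; apply: sub_completion_set; exact: rangeP.
Qed.
HB.instance Definition _ := GRing.isSubmodClosed.Build R[i] (bop H K)
  completion_pred completion_submod_closed.

Record completion_sort := Completion {
  completion_op :> bop H K;
  _ : completion_op \in completion_pred
}.

HB.instance Definition _ := [isSub for completion_op].
HB.instance Definition _ := [Choice of completion_sort by <:].
HB.instance Definition _ := [SubChoice_isSubLmodule of completion_sort by <:].

(* T o b belongs to the completion whenever b is in B; [insubd] only gives a
   value to the meaningless products with operators b outside B. *)
Definition completion : premod H := {|
  premod_sort := completion_sort;
  pact := fun T b => insubd (0 : completion_sort) (bcomp T b);
  pip := fun S T => bcomp (adj S) T
|}.

Fact completion_emb_subproof (x : X) : E x \in completion_pred.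
Proof. by rewrite !inE; apply: sub_completion_set; exists x. Qed.

Definition completion_emb (x : X) : completion :=
  Completion (completion_emb_subproof x).

End Completion.

(* Main.v *)
From HB Require Import structures.
Require Import Defs.
From mathcomp Require Import all_boot all_order all_algebra.
From mathcomp Require Import complex.
From mathcomp Require Import all_classical all_reals all_analysis.
From mathcomp Require Import ring lra.

Set Implicit Arguments.
Unset Strict Implicit.
Unset Printing Implicit Defensive.

Import Order.TTheory GRing.Theory Num.Theory.
Import numFieldNormedType.Exports.

Local Open Scope classical_set_scope.
Local Open Scope ring_scope.

(** Write K for the interior tensor product of X with H, so that X sits in
    B(H, K) through E and its completion is the WOT sequential closure of E(X).

    _Existence._ Every algebraic property of the completion survives WOT
    sequential limits in one variable at a time.  Left and right composition
    with a fixed operator and passage to the adjoint are WOT sequentially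
    continuous, and B is WOT sequentially closed, so [S^* T] lies in B because
    [(E x)^* (E y)] does ([completion_ip_mem]), and [T b] lies in the completion
    because [(E x) b = E (x b)] does ([completion_act_mem]).  The space K is
    also an interior tensor product of the completion with H, and in it the
    completion is WOT sequentially closed by construction.  Since WOT
    convergence implies WOT_B convergence, a subset that contains X and is
    closed under WOT_B limits is WOT sequentially closed, hence everything.
    Adjoints of operators between Hilbert spaces come from the Riesz
    representation theorem, which is proved on the way.

    _Uniqueness._ Let Y be another Sigma*-module with X embedded by i as a WOT_B
    sequentially dense submodule, and let F : Y -> B(H, L) be a representation
    with WOT sequentially closed range.  The vectors [E x z] and [F (i x) z]
    have the same inner products, so there is an isometry V : K -> L with
    [V (E x z) = F (i x) z] ([isometric_extension]).  The claim is that
    T |-> V T maps the completion onto F(Y); then U = F^-1 o (V _) is the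
    unitary.  That V T lies in F(Y) holds for T in E(X) and passes to WOT
    limits.  Conversely the y for which F y = V T for some T in the completion
    include i(X), and they form a WOT_B sequentially closed set provided that
    WOT_B convergence of u_n to y forces WOT convergence of F u_n to F y: then
    V^* F u_n converges to V^* F y, and V V^* F y = F y.  This proviso
    ([wotB_cvg_wot]) is the analytic core.  A WOT_B convergent sequence is
    norm bounded, by the uniform boundedness principle used on H and on the
    Banach space Y, and for bounded sequences weak convergence may be
    tested on the total set of vectors [F y w]. *)

(** * Real-valued norms and approximation *)

(** The norm of a complex normed space takes values in the partially
    ordered field R[i]; its real part is the same number in the totally ordered
    field R, where order arguments and real arithmetic are available. *)
Definition nrm (R : realType) (V : normedZmodType R[i]) (x : V) : R :=
  complex.Re `|x|.

Section RealNorm.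
Variable R : realType.
Local Notation C := R[i].

Lemma nrmE (V : normedZmodType C) (x : V) : `|x| = (nrm x)%:C%C.
Proof. by rewrite /nrm RRe_real // normr_real. Qed.

Lemma nrm_ge0 (V : normedZmodType C) (x : V) : 0 <= nrm x.
Proof. by rewrite -ler0c -nrmE. Qed.

Lemma nrm0 (V : normedZmodType C) : nrm (0 : V) = 0.
Proof. by rewrite /nrm normr0. Qed.

Lemma nrm_eq0 (V : normedZmodType C) (x : V) : nrm x = 0 -> x = 0.
Proof. by move=> x0; apply/normr0_eq0; rewrite nrmE x0. Qed.

Lemma nrmN (V : normedZmodType C) (x : V) : nrm (- x) = nrm x.
Proof. by rewrite /nrm normrN. Qed.

Lemma nrmBC (V : normedZmodType C) (x y : V) : nrm (x - y) = nrm (y - x).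
Proof. by rewrite -nrmN opprB. Qed.

Lemma nrmD (V : normedZmodType C) (x y : V) : nrm (x + y) <= nrm x + nrm y.
Proof. by rewrite -lecR rmorphD /= -!nrmE ler_normD. Qed.

Lemma nrmB (V : normedZmodType C) (x y z : V) :
  nrm (x - z) <= nrm (x - y) + nrm (y - z).
Proof. by rewrite (le_trans _ (nrmD _ _)) // addrA subrK. Qed.

Lemma nrmZ (V : normedModType C) (a : C) (x : V) : nrm (a *: x) = nrm a * nrm x.
Proof. by apply: complexI; rewrite rmorphM /= -!nrmE normrZ. Qed.

Lemma nrmM (a b : C) : nrm (a * b) = nrm a * nrm b.
Proof. by apply: complexI; rewrite rmorphM /= -!nrmE normrM. Qed.

Lemma nrm_real (r : R) : nrm (r%:C%C : C) = `|r|.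
Proof. by rewrite /nrm normc_def /= expr0n /= addr0 sqrtr_sqr. Qed.

Lemma nrm_conj (a : C) : nrm (Num.conj a) = nrm a.
Proof. by rewrite /nrm norm_conjC. Qed.

Lemma le_Re_nrm (a : C) : complex.Re a <= nrm a.
Proof.
rewrite -lecR -nrmE; apply: le_trans (normc_ge_Re a).
by rewrite lecR ler_norm.
Qed.

Lemma cvg_nrmP (V : normedModType C) (u : nat -> V) (l : V) :
  u @ \oo --> l <->
  forall e : R, 0 < e -> exists N, forall n, (N <= n)%N -> nrm (u n - l) < e.
Proof.
split=> [/cvgrPdistC_lt ul e e0|ul].
  have [|N _ uN] := ul (e%:C%C : C); first by rewrite ltcR.
  by exists N => n /uN /=; rewrite nrmE ltcR.
apply/cvgrPdistC_lt => e e0.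
have er : e = (complex.Re e)%:C%C by rewrite RRe_real // gtr0_real.
have [|N uN] := ul (complex.Re e); first by rewrite -ltcR -er.
by exists N => // n /uN; rewrite er nrmE ltcR.
Qed.

Lemma nrm_complete (V : completeNormedModType C) (u : nat -> V) :
  (forall e : R, 0 < e -> exists N, forall m n,
     (N <= m)%N -> (N <= n)%N -> nrm (u m - u n) < e) ->
  exists l, forall e : R, 0 < e -> exists N, forall n,
    (N <= n)%N -> nrm (u n - l) < e.
Proof.
move=> cu; suff cvu : cvg (u @ \oo).
  by exists (lim (u @ \oo)); apply/cvg_nrmP; exact: cvu.
apply: cauchy_cvg; apply: cauchy_exP => e e0.
have er : e = (complex.Re e)%:C%C by rewrite RRe_real // gtr0_real.
have [|N uN] := cu (complex.Re e); first by rewrite -ltcR -er.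
exists (u N); exists N => // n /= Nn.
by rewrite /= -ball_normE /= er nrmE ltcR uN.
Qed.

Lemma cvg_nrm_bounded (V : normedModType C) (u : nat -> V) (l : V) :
  u @ \oo --> l -> exists M : R, forall n, nrm (u n) <= M.
Proof.
move=> ul; have cu : cvg (u @ \oo) by apply/cvg_ex; exists l.
have /pinfty_ex_gt0[M _ Mu] := cvg_seq_bounded cu.
exists (complex.Re M) => n; have := Mu n I; rewrite /= nrmE lecE /=.
by case/andP.
Qed.

Lemma closure_nrmP (V : normedModType C) (A : set V) (x : V) :
  closure A x <-> forall e : R, 0 < e -> exists2 y, A y & nrm (x - y) < e.
Proof.
split=> [Ax e e0|Ax U /nbhs_ballP[e /= e0 eU]].
  have [|y [Ay]] := Ax (ball x (e%:C%C : C)).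
    by apply: nbhsx_ballx; rewrite ltcR.
  by rewrite -ball_normE /= nrmE ltcR => ?; exists y.
have er : e = (complex.Re e)%:C%C by rewrite RRe_real // gtr0_real.
have [|y Ay xy] := Ax (complex.Re e); first by rewrite -ltcR -er.
by exists y; split=> //; apply: eU; rewrite -ball_normE /= er nrmE ltcR.
Qed.

Lemma bounded_linearP (V W : normedModType C) (f : V -> W) : linear f ->
  continuous f <-> exists M : R, forall z, nrm (f z) <= M * nrm z.
Proof.
move=> lf.
pose f' := GRing.isLinear.Build C V W *:%R f lf.
pose g : {linear V -> W} := HB.pack f f'.
have -> : continuous f <-> continuous g by [].
rewrite -linear_bounded_continuous linear_boundedP; split.
  case=> M [Mr]; set b := (complex.Re M + 1).
  have bM : M < b%:C%C by rewrite -(RRe_real Mr) ltcR ltrDl.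
  by move=> /(_ _ bM) fb; exists b => z; rewrite -lecR rmorphM /= -!nrmE fb.
case=> M fM; exists (M%:C)%C; split; first by rewrite complex_real.
move=> r Mr z; rewrite (le_trans _ (ler_wpM2r _ (ltW Mr)))//.
by rewrite !nrmE -rmorphM lecR.
Qed.

Lemma natSinv_small (e : R) : 0 < e ->
  exists N, forall n, (N <= n)%N -> n.+1%:R^-1 < e.
Proof.
move=> e0; have [N _ Ne] := near_infty_natSinv_lt (PosNum e0).
by exists N => n /Ne.
Qed.

End RealNorm.

(** * Inner products *)

Section InnerProduct.
Variables (R : realType) (H : hilbertType R).
Implicit Types u v w z : H.
Local Notation C := R[i].

Lemma hipDr u v w : hip u (v + w) = hip u v + hip u w.
Proof. by rewrite /hip linearDl. Qed.

Lemma hipDl u v w : hip (u + v) w = hip u w + hip v w.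
Proof. by rewrite /hip linearD. Qed.

Lemma hipZr a u v : hip u (a *: v) = a * hip u v.
Proof. by rewrite /hip linearZl_LR. Qed.

Lemma hipZl a u v : hip (a *: u) v = Num.conj a * hip u v.
Proof. by rewrite /hip linearZ. Qed.

Lemma hipNr u v : hip u (- v) = - hip u v.
Proof. by rewrite /hip linearNl. Qed.

Lemma hipNl u v : hip (- u) v = - hip u v.
Proof. by rewrite /hip linearN. Qed.

Lemma hipBr u v w : hip u (v - w) = hip u v - hip u w.
Proof. by rewrite hipDr hipNr. Qed.

Lemma hipBl u v w : hip (u - v) w = hip u w - hip v w.
Proof. by rewrite hipDl hipNl. Qed.

Lemma hip0r u : hip u 0 = 0. Proof. by rewrite /hip linear0l. Qed.

Lemma hip0l u : hip 0 u = 0. Proof. by rewrite /hip linear0. Qed.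

Lemma hip_conj u v : hip v u = Num.conj (hip u v).
Proof. by rewrite /hip hermC expr0 mul1r. Qed.

Lemma hip_nrm u : hip u u = (nrm u ^+ 2)%:C%C.
Proof. by rewrite /hip hdotE nrmE rmorphXn. Qed.

Lemma hip_ge0 u : 0 <= hip u u.
Proof. by rewrite hip_nrm ler0c sqr_ge0. Qed.

Lemma nrm_sqE u : nrm u ^+ 2 = complex.Re (hip u u).
Proof. by rewrite hip_nrm. Qed.

Lemma Re_conj (a : C) : complex.Re (Num.conj a) = complex.Re a.
Proof. by case: a. Qed.

Lemma nrm_sqD u v :
  nrm (u + v) ^+ 2 = nrm u ^+ 2 + nrm v ^+ 2 + 2 * complex.Re (hip u v).
Proof.
rewrite !nrm_sqE hipDl !hipDr (hip_conj u v) !raddfD /= Re_conj; ring.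
Qed.

Lemma Re_realM (t : R) (a : C) :
  complex.Re ((t%:C)%C * a) = t * complex.Re a.
Proof. by case: a => a b /=; rewrite mul0r subr0. Qed.

Lemma conj_real (t : R) : Num.conj (t%:C%C : C) = (t%:C)%C.
Proof. by apply/CrealP; rewrite complex_real. Qed.

(** The vector [|v| u - |u| v] has a nonnegative square, which is
    [2 |u| |v| (|u| |v| - Re <u, v>)]. *)
Lemma Re_hip_le u v : complex.Re (hip u v) <= nrm u * nrm v.
Proof.
have [v0|v0] := eqVneq (nrm v) 0.
  by rewrite (nrm_eq0 v0) hip0r nrm0 mulr0.
have vp : 0 < nrm v by rewrite lt_neqAle eq_sym v0 nrm_ge0.
have [u0|u0] := eqVneq (nrm u) 0.
  by rewrite (nrm_eq0 u0) hip0l nrm0 mul0r.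
have up : 0 < nrm u by rewrite lt_neqAle eq_sym u0 nrm_ge0.
have := nrm_sqD (((nrm v)%:C)%C *: u) (- (((nrm u)%:C)%C *: v)).
rewrite nrmN !nrmZ hipNr hipZl hipZr conj_real !nrm_real !gtr0_norm //.
rewrite raddfN /= !Re_realM => e.
have := sqr_ge0 (nrm (((nrm v)%:C)%C *: u - ((nrm u)%:C)%C *: v)).
rewrite e => h; have vu : 0 < nrm v * nrm u by rewrite mulr_gt0.
rewrite -(ler_pM2l vu); nra.
Qed.

Lemma nrm_phase (a : C) : exists2 c : C, nrm c <= 1 & c * a = ((nrm a)%:C)%C.
Proof.
have [->|a0] := eqVneq a 0.
  by exists 0; [rewrite nrm0|rewrite mul0r nrm0].
exists (`|a| / a); last by rewrite divfK // nrmE.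
by rewrite /nrm normrM normrV ?unitfE // normr_id divff // normr_eq0.
Qed.

(** Rotating v by a phase makes the inner product real and nonnegative, which
    reduces to the bound on real parts. *)
Lemma cauchy_schwarz u v : nrm (hip u v) <= nrm u * nrm v.
Proof.
have [c c1 ca] := nrm_phase (hip u v).
have := Re_hip_le u (c *: v); rewrite hipZr ca /= nrmZ => /le_trans; apply.
by rewrite ler_wpM2l ?nrm_ge0 // ler_piMl ?nrm_ge0.
Qed.

(** The tool by which the operator identities below are checked weakly. *)
Lemma hip_inj u v : (forall w, hip w u = hip w v) -> u = v.
Proof.
move=> uv; apply/subr0_eq/nrm_eq0/eqP; rewrite -(sqrf_eq0 (nrm _)); apply/eqP.
by rewrite nrm_sqE hipBr uv subrr.
Qed.

Lemma le_nrm_hip u (M : R) : 0 <= M ->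
  (forall v, nrm (hip v u) <= M * nrm v) -> nrm u <= M.
Proof.
move=> M0 /(_ u); rewrite hip_nrm nrm_real ger0_norm ?sqr_ge0 // expr2.
have [->|u0] := eqVneq (nrm u) 0; first by [].
by rewrite ler_pM2r // lt_neqAle eq_sym u0 nrm_ge0.
Qed.

End InnerProduct.

(** * The Riesz representation theorem *)

(** The functional f is represented by the minimiser of the energy
    [g z = |z|^2 - 2 Re f z]: it is bounded below, the parallelogram law makes
    minimising sequences Cauchy, and stationarity of g along real lines through
    the minimiser v says [Re <v, w> = Re (f w)] for all w. *)
Section Riesz.
Variables (R : realType) (H : hilbertType R).
Local Notation C := R[i].
Variables (f : H -> C) (M : R).
Hypothesis f_lin : forall a u v, f (a *: u + v) = a * f u + f v.
Hypothesis f_bnd : forall z, nrm (f z) <= M * nrm z.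

Let g z := nrm z ^+ 2 - 2 * complex.Re (f z).

Let g_lb z : - M ^+ 2 <= g z.
Proof.
have := le_trans (le_Re_nrm (f z)) (f_bnd z).
by rewrite /g; have := sqr_ge0 (nrm z - M); nra.
Qed.

Let g_has_inf : has_inf (range g).
Proof.
by split; [exists (g 0), 0|exists (- M ^+ 2) => _ [z _ <-]; exact: g_lb].
Qed.

Let m := inf (range g).

Let m_le z : m <= g z.
Proof. by apply: ge_inf; [case: g_has_inf|exists z]. Qed.

(* The parallelogram law, written for the energy. *)
Let g_mid u v :
  nrm (u - v) ^+ 2 = 2 * g u + 2 * g v - 4 * g ((2^-1)%:C%C *: (u + v)).
Proof.
have fD a b : f (a + b) = f a + f b by rewrite -[a]scale1r f_lin mul1r scale1r.
have f0 : f 0 = 0 by apply/(addrI (f 0)); rewrite -fD !addr0.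
have fZ a b : f (a *: b) = a * f b by rewrite -[a *: b]addr0 f_lin f0 addr0.
rewrite /g nrmZ nrm_real gtr0_norm ?invr_gt0 // fZ fD Re_realM raddfD /=.
rewrite exprMn !nrm_sqD nrmN hipNr raddfN /=; lra.
Qed.

Let gD z w (t : R) : g (z + (t%:C)%C *: w) =
  g z + t ^+ 2 * nrm w ^+ 2 + 2 * t * complex.Re (hip z w - f w).
Proof.
have ft : f (z + (t%:C)%C *: w) = (t%:C)%C * f w + f z.
  by rewrite [z + _]addrC f_lin.
rewrite /g ft nrm_sqD nrmZ nrm_real hipZr exprMn real_normK ?num_real //.
by rewrite [complex.Re (_ + f z)]raddfD raddfB /= !Re_realM; ring.
Qed.


Let minimizer : exists v, g v <= m.
Proof.
have near_min n : exists z, g z < m + n.+1%:R^-1.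
  have [|_ [z _ <-] zm] := @inf_adherent _ _ n.+1%:R^-1 _ g_has_inf.
    by rewrite invr_gt0.
  by exists z.
have /choice[v vm] := near_min.
have [e e0|w vw] := @nrm_complete _ H v.
  have [|N Ne] := @natSinv_small R (e ^+ 2 / 4).
    by rewrite divr_gt0 // exprn_gt0.
  exists N => i j Ni Nj; rewrite -(@ltr_pXn2r _ 2) ?nnegrE ?nrm_ge0 ?ltW //.
  rewrite g_mid; have := m_le ((2^-1)%:C%C *: (v i + v j)).
  have := vm i; have := vm j; have := Ne i Ni; have := Ne j Nj.
  by move: (i.+1%:R^-1) (j.+1%:R^-1) (g (_ *: _)) => a b c; lra.
(* The limit w of the minimising sequence: going from [v n] to w raises the
   energy by at most [d * K], as soon as [|v n - w| < d <= 1]. *)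
exists w; apply/ler_addgt0Pr => e e0.
have M0 := normr_ge0 M; have w0 := nrm_ge0 w.
pose K := 3 + 2 * nrm w + 2 * `|M|.
have K0 : 0 < K by rewrite /K; lra.
pose d := Num.min 1 (e / (2 * K)).
have d0 : 0 < d by rewrite lt_min ltr01 divr_gt0 // mulr_gt0.
have dK : d * K <= e / 2.
  rewrite -ler_pdivlMr // -mulrA -invfM ge_min; apply/orP; right.
  by [].
have d1 : d <= 1 by rewrite ge_min lexx.
have [N1 vN1] := vw d d0.
have [|N2 vN2] := @natSinv_small R (e / 2); first by rewrite divr_gt0.
pose n := maxn N1 N2.
have {vN1}dn := vN1 n (leq_maxl _ _).
have {vN2}en := vN2 n (leq_maxr _ _).
have := gD (v n) (w - v n) 1.
rewrite scale1r addrC subrK => ->; rewrite expr1n mul1r mulr1 raddfB /=.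
have := vm n; have := le_Re_nrm (- f (w - v n)); rewrite nrmN raddfN /=.
have := f_bnd (w - v n); have := Re_hip_le (v n) (w - v n).
have := nrmD (v n - w) w; rewrite subrK.
move: dn; rewrite (nrmBC w); set r := nrm (v n - w) => rd.
have r0 : 0 <= r := nrm_ge0 _.
have Mr : M * r <= `|M| * r by rewrite ler_wpM2r // ler_norm.
have wr : nrm w * r <= nrm w * d by rewrite ler_wpM2l // ltW.
have Mrd : `|M| * r <= `|M| * d by rewrite ler_wpM2l // ltW.
have rr : r ^+ 2 <= d by nra.
move=> vnr.
have vr : nrm (v n) * r <= (r + nrm w) * r by rewrite ler_wpM2r.
move: dK; rewrite /K; move: (n.+1%:R^-1) en => a.
lra.
Qed.

Theorem riesz_representation : exists v, forall z, f z = hip v z.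
Proof.
have [v gv] := minimizer; exists v.
have Re0 z : complex.Re (hip v z - f z) = 0.
  set a := complex.Re _.
  have gt t : 0 <= t ^+ 2 * nrm z ^+ 2 + 2 * t * a.
    by have := le_trans gv (m_le (v + (t%:C)%C *: z)); rewrite gD -/a; lra.
  have := sqr_ge0 (nrm z) => z0.
  have p : 0 < nrm z ^+ 2 + 1 by lra.
  (* The quadratic [t^2 |z|^2 + 2 t a] is negative at this t unless a = 0. *)
  have := gt (- (a / (nrm z ^+ 2 + 1))).
  set q := a / _; have -> : a = q * (nrm z ^+ 2 + 1) by rewrite divfK // gt_eqF.
  move=> h; have : q ^+ 2 <= 0 by nra.
  rewrite real_exprn_even_le0 ?num_real //= => /eqP ->; by rewrite mul0r.
have fZ a b : f (a *: b) = a * f b.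
  have fD x y : f (x + y) = f x + f y by rewrite -[x]scale1r f_lin mul1r scale1r.
  have f0 : f 0 = 0 by apply/(addrI (f 0)); rewrite -fD !addr0.
  by rewrite -[a *: b]addr0 f_lin f0 addr0.
move=> z; apply/esym/subr0_eq.
(* Real parts on the line of 'i z give the imaginary parts. *)
have := Re0 ('i%C *: z); rewrite fZ hipZr -mulrBr.
have := Re0 z; case: (_ - _) => a b /= ->.
by rewrite mulr0 mul1r sub0r => /eqP; rewrite oppr_eq0 => /eqP ->.
Qed.
End Riesz.

(** * Bounded operators and adjoints *)

Section Composition.
Variables (C : numFieldType) (U V W Z : normedModType C).

Lemma bcompDl (S T : bop V W) (b : bop U V) :
  bcomp (S + T) b = bcomp S b + bcomp T b.
Proof. by apply/val_inj/funext. Qed.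

Lemma bcompDr (T : bop V W) (b c : bop U V) :
  bcomp T (b + c) = bcomp T b + bcomp T c.
Proof. by apply/val_inj/funext => z; exact: (linearD T). Qed.

Lemma bcompZl a (T : bop V W) (b : bop U V) :
  bcomp (a *: T) b = a *: bcomp T b.
Proof. by apply/val_inj/funext. Qed.

Lemma bcompZr a (T : bop V W) (b : bop U V) :
  bcomp T (a *: b) = a *: bcomp T b.
Proof. by apply/val_inj/funext => z; exact: linearZ. Qed.

Lemma bcompA (T : bop W Z) (b : bop V W) (c : bop U V) :
  bcomp T (bcomp b c) = bcomp (bcomp T b) c.
Proof. by apply/val_inj/funext. Qed.

End Composition.

Section Operators.
Variable R : realType.
Implicit Types H K L : hilbertType R.

Lemma bop_ext (V W : normedModType R[i]) (S T : bop V W) : S =1 T -> S = T.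
Proof. by move=> ST; apply/val_inj/funext. Qed.

Lemma bopD (V W : normedModType R[i]) (S T : bop V W) z :
  (S + T) z = S z + T z.
Proof. by []. Qed.

Lemma bopZ (V W : normedModType R[i]) a (T : bop V W) z :
  (a *: T) z = a *: T z.
Proof. by []. Qed.

Lemma bopB (V W : normedModType R[i]) (S T : bop V W) z :
  (S - T) z = S z - T z.
Proof. by []. Qed.

Lemma bop_bounded (V W : normedModType R[i]) (T : bop V W) :
  exists2 M : R, 0 <= M & forall z, nrm (T z) <= M * nrm z.
Proof.
have [M TM] := (iffLR (bounded_linearP (bop_linear T))) (@bop_continuous _ _ _ T).
exists `|M|; first exact: normr_ge0.
by move=> z; rewrite (le_trans (TM z)) // ler_wpM2r ?nrm_ge0 // ler_norm.
Qed.

Lemma bop_le_ball (V W : normedModType R[i]) (T : bop V W) (M : R) :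
  (forall z, nrm z <= 1 -> nrm (T z) <= M) -> forall z, nrm (T z) <= M * nrm z.
Proof.
move=> TM z; have [z0|z0] := eqVneq (nrm z) 0.
  by rewrite (nrm_eq0 z0) linear0 !nrm0 mulr0.
have zp : 0 < nrm z by rewrite lt_neqAle eq_sym z0 nrm_ge0.
rewrite -ler_pdivrMr // mulrC.
have -> : (nrm z)^-1 * nrm (T z) = nrm (T (((nrm z)^-1)%:C%C *: z)).
  by rewrite linearZ nrmZ nrm_real gtr0_norm // invr_gt0.
by apply: TM; rewrite nrmZ nrm_real gtr0_norm ?invr_gt0 // mulVf.
Qed.

Lemma bop_of_bounded (V W : normedModType R[i]) (f : V -> W) (M : R) :
  linear f -> (forall z, nrm (f z) <= M * nrm z) ->
  exists T : bop V W, forall z, T z = f z.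
Proof.
move=> lf fM; have fb : f \in @bounded_op _ V W.
  by apply/asboolP; split=> //; apply/(bounded_linearP lf); exists M.
by exists (Bop fb).
Qed.

(** The defining choice in [adj] is never vacuous: the functional
    [z |-> <w, T z>] is bounded, so Riesz provides [T^* w]. *)
Lemma adjP H K (T : bop H K) z w : hip (adj T w) z = hip w (T z).
Proof.
suff [S ST] : exists S : bop K H, forall z w, hip (S w) z = hip w (T z).
  rewrite /adj; case: xgetP => [S' _ /= -> //|/(_ S)/=]; by move=> /(_ ST).
have [M M0 TM] := bop_bounded T.
have /choice[S SP] w' : exists v, forall z', hip w' (T z') = hip v z'.
  apply: (@riesz_representation _ _ _ (nrm w' * M)) => [a u v|v].
    by rewrite linearP hipDr hipZr.
  by rewrite (le_trans (cauchy_schwarz _ _)) // -mulrA ler_wpM2l ?nrm_ge0.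
have lS : linear S.
  move=> a u v; apply: hip_inj => x; rewrite hip_conj -SP hipDl hipZl !SP.
  by rewrite hipDr hipZr rmorphD rmorphM /= conjCK -!hip_conj.
have SM w' : nrm (S w') <= M * nrm w'.
  apply: le_nrm_hip => [|v]; first by rewrite mulr_ge0 ?nrm_ge0.
  rewrite hip_conj nrm_conj -SP (le_trans (cauchy_schwarz _ _)) //.
  by rewrite (mulrC M) -mulrA ler_wpM2l ?nrm_ge0.
have [S' S'E] := bop_of_bounded lS SM.
by exists S' => z' w'; rewrite S'E SP.
Qed.

Lemma adjPr H K (T : bop H K) z w : hip z (adj T w) = hip (T z) w.
Proof. by rewrite hip_conj adjP -hip_conj. Qed.

Lemma adj_unique H K (T : bop H K) (S : bop K H) :
  (forall z w, hip (S w) z = hip w (T z)) -> S = adj T.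
Proof.
move=> ST; apply: bop_ext => w; apply: hip_inj => z.
by rewrite !(hip_conj _ z) ST adjP.
Qed.

Lemma hip_adj_comp H K (S T : bop H K) z w :
  hip z (bcomp (adj S) T w) = hip (S z) (T w).
Proof. exact: adjPr. Qed.

Lemma opnorm_has_sup H K (T : bop H K) :
  has_sup [set complex.Re `|T z| | z in [set z : H | `|z| <= 1]].
Proof.
split; first by exists (complex.Re `|T 0|), 0; rewrite //= normr0 ler01.
have [M M0 TM] := bop_bounded T; exists M => _ [z /= z1 <-].
rewrite -/(nrm _) (le_trans (TM z)) // ler_piMr //.
by rewrite -lecR -nrmE.
Qed.

Lemma le_opnorm H K (T : bop H K) z : nrm (T z) <= opnorm T * nrm z.
Proof.
apply: bop_le_ball => {}z z1; apply: sup_upper_bound.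
  exact: opnorm_has_sup.
by exists z; rewrite //= nrmE lecR.
Qed.

Lemma opnorm_ge0 H K (T : bop H K) : 0 <= opnorm T.
Proof.
rewrite -(nrm0 K) -(linear0 T); apply: sup_upper_bound.
  exact: opnorm_has_sup.
by exists 0; rewrite //= normr0 ler01.
Qed.

Lemma opnorm_le H K (T : bop H K) (M : R) : 0 <= M ->
  (forall z, nrm (T z) <= M * nrm z) -> opnorm T <= M.
Proof.
move=> M0 TM; apply: ge_sup; first by case: (opnorm_has_sup T).
move=> _ [z /= z1 <-]; rewrite -/(nrm _) (le_trans (TM z)) // ler_piMr //.
by rewrite -lecR -nrmE.
Qed.

(** The Cauchy condition makes the pointwise limit uniform on balls, which is
    what gives back linearity and boundedness.  Estimates are pointwise because
    [opnorm] is only defined between Hilbert spaces. *)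
Lemma bop_complete (V : normedModType R[i]) (W : completeNormedModType R[i])
    (u : nat -> bop V W) :
  (forall e : R, 0 < e -> exists N, forall m n, (N <= m)%N -> (N <= n)%N ->
     forall z, nrm (u m z - u n z) <= e * nrm z) ->
  exists T : bop V W, forall e : R, 0 < e -> exists N, forall n, (N <= n)%N ->
     forall z, nrm (u n z - T z) <= e * nrm z.
Proof.
move=> cu.
have /choice[f uf] z : exists l, forall e : R, 0 < e -> exists N, forall n,
    (N <= n)%N -> nrm (u n z - l) < e.
  apply: nrm_complete => e e0; have z1 : 0 < nrm z + 1 by rewrite ltr_wpDl ?nrm_ge0.
  have [|N Ne] := cu (e / (nrm z + 1)); first by rewrite divr_gt0.
  exists N => m n Nm Nn; rewrite (le_lt_trans (Ne m n Nm Nn z)) //.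
  by rewrite mulrAC ltr_pdivrMr // ltr_pM2l // ltrDl.
have uniform (e : R) : 0 < e -> exists N, forall n, (N <= n)%N ->
    forall z, nrm (u n z - f z) <= e * nrm z.
  move=> e0; have [N Ne] := cu e e0; exists N => n Nn z.
  apply/ler_addgt0Pr => d d0; have [N' Nd] := uf z d d0.
  rewrite (le_trans (nrmB _ (u (maxn N N') z) _)) // lerD //.
    by apply: Ne; rewrite // leq_maxl.
  by rewrite ltW // Nd // leq_maxr.
have lf : linear f.
  move=> a x y; apply/subr0_eq/nrm_eq0/eqP; rewrite eq_le nrm_ge0 andbT.
  apply/ler_addgt0Pr => e e0; rewrite add0r.
  pose k := 2 + nrm a; have k0 : 0 < k by rewrite ltr_pwDl ?nrm_ge0.
  have ek : 0 < e / k by rewrite divr_gt0.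
  have [N1 /(_ _ (leq_trans (leq_maxl N1 _) (leq_maxl _ _))) N1e] := uf x _ ek.
  have [N2 /(_ _ (leq_trans (leq_maxr _ N2) (leq_maxl _ _))) N2e] := uf y _ ek.
  have [N3 N3e] := uf (a *: x + y) _ ek.
  have {}N1e := N1e N2 N3; have {}N2e := N2e N1 N3.
  have {}N3e := N3e _ (leq_maxr (maxn N1 N2) N3).
  move: (maxn _ N3) N1e N2e N3e => n xn yn axyn.
  have -> : f (a *: x + y) - (a *: f x + f y) =
      - (u n (a *: x + y) - f (a *: x + y)) + (a *: (u n x - f x) + (u n y - f y)).
    by rewrite opprB scalerBr [X in _ = _ + X]addrACA -opprD -linearP addrA subrK.
  rewrite (le_trans (nrmD _ _)) // nrmN (le_trans (lerD (lexx _) (nrmD _ _))) //.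
  rewrite nrmZ; have -> : e = k * (e / k) by rewrite mulrC divfK // gt_eqF.
  have := ler_wpM2l (nrm_ge0 a) (ltW xn); rewrite {2}/k; lra.
have [M fM] : exists M : R, forall z, nrm (f z) <= M * nrm z.
  have [N Ne] := uniform 1 ltr01; have [M _ uM] := bop_bounded (u N).
  exists (M + 1) => z; have := nrmB (f z) (u N z) 0; rewrite !subr0 nrmBC.
  by have := Ne N (leqnn _) z; have := uM z; lra.
have [T Tf] := bop_of_bounded lf fM; exists T => e /uniform[N Ne].
by exists N => n /Ne + z; rewrite Tf; exact.
Qed.

End Operators.

(** * The uniform boundedness principle *)

(** The principle is needed both for Hilbert spaces and for the Banach space
    underlying a C*-module, whose norm is not attached to a normed type; hence
    the formulation for a vector space with a complete seminorm p and a family A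
    of p-continuous seminorms. *)
Section UniformBoundedness.
Variables (R : realType) (V : lmodType R[i]).

Definition seminorm (q : V -> R) : Prop :=
  (forall x y, q (x + y) <= q x + q y) /\
  (forall a x, q (a *: x) = nrm a * q x).

Definition complete_for (p : V -> R) : Prop := forall u : nat -> V,
  (forall e, 0 < e -> exists N, forall m n,
     (N <= m)%N -> (N <= n)%N -> p (u m - u n) < e) ->
  exists x, forall e, 0 < e -> exists N, forall n, (N <= n)%N -> p (u n - x) < e.

Lemma seminormN q x : seminorm q -> q (- x) = q x.
Proof. by case=> _ qZ; rewrite -scaleN1r qZ nrmN /nrm normr1 /= mul1r. Qed.

Lemma seminorm0 q : seminorm q -> q 0 = 0.
Proof. by case=> _ qZ; rewrite -(scale0r 0) qZ nrm0 mul0r. Qed.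

Lemma seminorm_ge0 q x : seminorm q -> 0 <= q x.
Proof.
move=> sq; have := sq.1 x (- x); rewrite subrr (seminorm0 sq) (seminormN _ sq).
by rewrite -mulr2n pmulrn_lge0.
Qed.

Lemma seminormBC q x y : seminorm q -> q (x - y) = q (y - x).
Proof. by move=> sq; rewrite -opprB seminormN. Qed.

Lemma seminorm_sub q x y z : seminorm q -> q (x - z) <= q (x - y) + q (y - z).
Proof. by move=> sq; rewrite (le_trans _ (sq.1 _ _)) // addrA subrK. Qed.

Variables (p : V -> R) (A : set (V -> R)).
Hypotheses (p_seminorm : seminorm p) (p_complete : complete_for p).
Hypothesis A_seminorm : forall q, A q -> seminorm q.
Hypothesis A_continuous : forall q, A q -> exists K, forall x, q x <= K * p x.
Hypothesis A_bounded : forall x, exists M, forall q, A q -> q x <= M.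

(** Nested balls.  If A is not uniformly bounded then every ball contains a
    smaller one on which some member of A exceeds n.  The radii tend to 0, so
    completeness gives a common point of the balls, where A is unbounded. *)
Theorem uniform_boundedness : exists K, forall q, A q -> forall x, q x <= K * p x.
Proof.
apply: contrapT => unb.
have large K : exists q x, A q /\ K * p x < q x.
  apply: contrapT => none; apply: unb; exists K => q Aq x.
  by rewrite leNgt; apply/negP => xq; apply: none; exists q, x.
have step (n : nat) (x0 : V) (r : R) : 0 < r -> exists (x : V) (r' : R),
    [/\ 0 < r', r' <= n.+1%:R^-1, (forall y, p (y - x) <= r' -> p (y - x0) <= r) &
    exists2 q, A q & forall y, p (y - x) <= r' -> n%:R < q y].
  move=> r0; pose s := r / 2; have s0 : 0 < s by rewrite divr_gt0.
  have [q [y0 [Aq]]] := large (n.+1%:R / s).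
  have sq := A_seminorm Aq; have [K qK] := A_continuous Aq.
  have qy0 : 0 < p y0 -> n.+1%:R / s * p y0 < q y0 ->
      exists2 y, p y = s & n.+1%:R < q y.
    move=> py0 ny; exists ((s / p y0)%:C%C *: y0).
      by rewrite p_seminorm.2 nrm_real gtr0_norm ?divr_gt0 // divfK ?gt_eqF.
    rewrite sq.2 nrm_real gtr0_norm ?divr_gt0 // mulrAC ltr_pdivlMr //.
    by move: ny; rewrite mulrAC ltr_pdivrMr // (mulrC s).
  have [p0 ny|p0 ny] := eqVneq (p y0) 0.
    by have := qK y0; rewrite p0 mulr0 leNgt; move: ny; rewrite p0 mulr0 => ->.
  have py0 : 0 < p y0 by rewrite lt_neqAle eq_sym p0 seminorm_ge0.
  have [y py qy] := qy0 py0 ny.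
  (* The points x0 + y and x0 - y differ by 2 y, so q exceeds n + 1 at one of
     them. *)
  have [x px qx] : exists2 x, p (x - x0) = s & n.+1%:R < q x.
    have := sq.1 (x0 + y) (- (x0 - y)); rewrite (seminormN _ sq).
    rewrite opprB addrC addrA subrK -mulr2n -scaler_nat sq.2.
    rewrite (_ : nrm _ = 2); last by rewrite /nrm normr_nat.
    have [nx _|nx qq] := ltP n.+1%:R (q (x0 + y)).
      by exists (x0 + y); rewrite // addrAC subrr add0r.
    exists (x0 - y); first by rewrite addrAC subrr add0r seminormN.
    by lra.
  (* Small enough for the ball to stay inside the old one, for the radii to tend
     to 0, and for q to vary by at most 1. *)
  pose r' := Num.min s (Num.min n.+1%:R^-1 (`|K| + 1)^-1).
  have K1 : 0 < `|K| + 1 by rewrite ltr_wpDl.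
  have r'0 : 0 < r' by rewrite !lt_min s0 !invr_gt0 K1 ltr0n.
  exists x, r'; split=> //; first by rewrite !ge_min lexx orbT.
    move=> z zx; rewrite (le_trans (seminorm_sub z x x0 p_seminorm)) // px.
    have : r' <= s by rewrite ge_min lexx.
    by rewrite /s; lra.
  exists q => // z zx; have qxz := sq.1 z (x - z).
  move: qxz; rewrite addrC subrK => qxz; have := qK (x - z).
  rewrite (seminormBC _ _ p_seminorm) => qKz.
  suff : K * p (z - x) <= 1 by move: qx; rewrite -natr1; lra.
  have Kr : (`|K| + 1) * r' <= 1.
    by rewrite mulrC -ler_pdivlMr // mul1r !ge_min lexx !orbT.
  have := ler_norm K; have := seminorm_ge0 (z - x) p_seminorm.
  by have := normr_ge0 K; nra.
pose refines (nc : nat * (V * {posnum R})) (c' : V * {posnum R}) :=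
  [/\ c'.2%:num <= nc.1.+1%:R^-1,
      (forall y, p (y - c'.1) <= c'.2%:num -> p (y - nc.2.1) <= nc.2.2%:num) &
      exists2 q, A q & forall y, p (y - c'.1) <= c'.2%:num -> nc.1%:R < q y].
have {}step nc : exists c', refines nc c'.
  have [x [r [r0 ? ? ?]]] := step nc.1 nc.2.1 nc.2.2%:num [gt0 of nc.2.2%:num].
  by exists (x, PosNum r0); split.
have [next nextP] := choice step.
pose c := fix c n : V * {posnum R} :=
  if n is n'.+1 then next (n', c n') else (0, PosNum ltr01).
have cP n := nextP (n, c n).
have nest n k : forall y, p (y - (c (n + k)%N).1) <= (c (n + k)%N).2%:num ->
    p (y - (c n).1) <= (c n).2%:num.
  elim: k => [|k IH] y; first by rewrite addn0.
  by rewrite addnS => yc; apply: IH; have [_ + _] := cP (n + k)%N; apply.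
have near n m : (n <= m)%N -> p ((c m).1 - (c n).1) <= (c n).2%:num.
  move=> nm; apply: (nest n (m - n)%N); rewrite subnKC // subrr seminorm0 //.
have small (e : R) : 0 < e -> exists n, (c n).2%:num < e.
  move=> e0; have [N Ne] := natSinv_small e0.
  exists N.+1; have [cN _ _] := cP N; apply: le_lt_trans cN _.
  exact: (Ne N (leqnn _)).
have [e e0|x xP] := p_complete (u := fun n => (c n).1).
  have [|N Ne] := small (e / 2); first by rewrite divr_gt0.
  exists N => m n Nm Nn /=.
  have := seminorm_sub (c m).1 (c N).1 (c n).1 p_seminorm.
  have := near _ _ Nm; have := near _ _ Nn.
  rewrite (seminormBC (c N).1 _ p_seminorm); lra.
have xc n : p (x - (c n).1) <= (c n).2%:num.
  apply/ler_addgt0Pr => e e0; have [N Ne] := xP e e0.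
  have := seminorm_sub x (c (maxn N n)).1 (c n).1 p_seminorm.
  have := near n _ (leq_maxr N n); have := Ne _ (leq_maxl N n).
  rewrite (seminormBC _ x p_seminorm); lra.
have [M qM] := A_bounded x.
have [_ _ [q Aq]] := cP (Num.truncn `|M|).+1.
move=> /(_ x (xc _.+1)); apply/negP; rewrite -leNgt (le_trans (qM q Aq)) //.
by rewrite (le_trans (ler_norm M)) // ltW // truncnS_gt.
Qed.

End UniformBoundedness.

(** * Weak operator convergence *)

Section OperatorConvergence.
Variable R : realType.
Implicit Types H K L : hilbertType R.

Lemma wot_cvgP H K (u : nat -> bop H K) (T : bop H K) :
  wot_cvg u T <-> forall z w (e : R), 0 < e -> exists N, forall n, (N <= n)%N ->
    nrm (hip (u n z - T z) w) < e.
Proof.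
split=> [uT z w e e0|uT z w].
  have [N Ne] := (iffLR (cvg_nrmP _ _)) (uT z w) e e0.
  by exists N => n /Ne; rewrite hipBl.
apply/cvg_nrmP => e e0; have [N Ne] := uT z w e e0.
by exists N => n /Ne; rewrite hipBl.
Qed.

Lemma wot_cvg_unique (L M : hilbertType R) (u : nat -> bop L M) (S T : bop L M) :
  wot_cvg u S -> wot_cvg u T -> S = T.
Proof.
move=> uS uT; apply: bop_ext => z; apply: hip_inj => w.
rewrite hip_conj [RHS]hip_conj; congr (Num.conj _).
exact: (cvg_unique (@norm_hausdorff _ R[i]^o) (uS z w) (uT z w)).
Qed.

Lemma nrm_complete_for H : complete_for (@nrm R H).
Proof. by move=> u /nrm_complete. Qed.

Lemma seminorm_nrm H : seminorm (@nrm R H).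
Proof. by split=> [x y|a x]; [exact: nrmD|exact: nrmZ]. Qed.

(** Uniform boundedness twice: for fixed z the functionals [<u n z, _>]
    converge pointwise, so [u n z] is bounded; hence so is the sequence u. *)
Lemma wot_cvg_bounded H K (u : nat -> bop H K) (T : bop H K) : wot_cvg u T ->
  exists2 M : R, 0 <= M & forall n z, nrm (u n z) <= M * nrm z.
Proof.
move=> uT.
have ptw z : exists M : R, forall n, nrm (u n z) <= M.
  have [|_ [n _ <-]|_ [n _ <-]|w|M uM] := @uniform_boundedness R K (@nrm R K)
    [set (fun w => nrm (hip (u n z) w)) | n in setT] (@seminorm_nrm K).
  - exact: nrm_complete_for.
  - split=> [w w'|a w]; first by rewrite hipDr nrmD.
    by rewrite hipZr nrmM.
  - by exists (nrm (u n z)) => w; exact: cauchy_schwarz.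
  - have [M uM] := cvg_nrm_bounded (uT z w).
    by exists M => _ [n _ <-].
  exists `|M| => n; apply: le_nrm_hip => // w.
  rewrite hip_conj nrm_conj (le_trans (uM _ (ex_intro2 _ _ n I erefl) w)) //.
  by rewrite ler_wpM2r ?nrm_ge0 // ler_norm.
have [|_ [n _ <-]|_ [n _ <-]|z|M uM] := @uniform_boundedness R H (@nrm R H)
    [set (fun z => nrm (u n z)) | n in setT] (@seminorm_nrm H).
- exact: nrm_complete_for.
- split=> [z z'|a z]; first by rewrite linearD nrmD.
  by rewrite linearZ nrmZ.
- by have [M _ uM] := bop_bounded (u n); exists M.
- by have [M uM] := ptw z; exists M => _ [n _ <-].
exists `|M| => // n z; rewrite (le_trans (uM _ (ex_intro2 _ _ n I erefl) z)) //.
by rewrite ler_wpM2r ?nrm_ge0 // ler_norm.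
Qed.

(** For a bounded sequence, weak convergence to 0 need only be tested on a total
    set: the vectors w with [<a n, w>] tending to 0 form a closed subspace. *)
Lemma weak_cvg0_dense K (a : nat -> K) (M : R) (G : set K) :
  (forall n, nrm (a n) <= M) -> closure (lspan G) = setT ->
  (forall w, G w -> forall e : R, 0 < e -> exists N, forall n, (N <= n)%N ->
     nrm (hip (a n) w) < e) ->
  forall w (e : R), 0 < e -> exists N, forall n, (N <= n)%N ->
     nrm (hip (a n) w) < e.
Proof.
move=> aM Gd Ga w e e0.
have : closure (lspan G) w by rewrite Gd.
have K0 : 0 < 2 * (`|M| + 1) by rewrite mulr_gt0 // ltr_wpDl.
move/closure_nrmP => /(_ (e / (2 * (`|M| + 1)))) [|y Gy wy].
  by rewrite divr_gt0.
suff [N Ne] : exists N, forall n, (N <= n)%N -> nrm (hip (a n) y) < e / 2.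
  exists N => n Nn; have -> : w = y + (w - y) by rewrite addrC subrK.
  rewrite hipDr (le_lt_trans (nrmD _ _)) // (splitr e) ltr_leD ?Ne //.
  rewrite (le_trans (cauchy_schwarz _ _)) //.
  have aM1 : nrm (a n) <= `|M| + 1 by rewrite ler_wpDr // (le_trans (aM n)) // ler_norm.
  rewrite (le_trans (ler_pM (nrm_ge0 _) (nrm_ge0 _) aM1 (ltW wy))) //.
  by rewrite le_eqVlt; apply/orP; left; apply/eqP; field; rewrite gt_eqF // ltr_wpDl.
have : 0 < e / 2 by rewrite divr_gt0.
case: Gy => n [c [g [Gg ->]]]; move: (e / 2) => {w wy K0 e e0 y} e e0.
elim: n c g Gg e e0 => [|n IH] c g Gg e e0.
  by exists 0%N => n _; rewrite big_ord0 hip0r nrm0.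
have e2 : 0 < e / 2 by rewrite divr_gt0.
have [N1 N1e] := IH (fun i => c (lift ord0 i)) (fun i => g (lift ord0 i))
  (fun i => Gg _) _ e2.
have c0 : 0 < nrm (c ord0) + 1 by rewrite ltr_wpDl ?nrm_ge0.
have [|N2 N2e] := Ga _ (Gg ord0) (e / 2 / (nrm (c ord0) + 1)).
  by rewrite divr_gt0.
exists (maxn N1 N2) => k; rewrite geq_max => /andP[k1 k2].
rewrite big_ord_recl hipDr hipZr addrC (le_lt_trans (nrmD _ _)) // (splitr e).
rewrite ltr_leD ?N1e // nrmM; have := N2e k k2; rewrite ltr_pdivlMr // mulrC.
by have := nrm_ge0 (hip (a k) (g ord0)); nra.
Qed.

Lemma wot_cvg_adj H K (u : nat -> bop H K) (T : bop H K) :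
  wot_cvg u T -> wot_cvg (fun n => adj (u n)) (adj T).
Proof.
move=> /wot_cvgP uT; apply/wot_cvgP => z w e e0.
have [N Ne] := uT w z e e0; exists N => n /Ne.
by rewrite -nrm_conj -hip_conj hipBl !adjP -hipBr.
Qed.

(** Composition is separately WOT continuous: a fixed left factor S moves to
    the other side of the inner product as [S^*]. *)
Lemma wot_cvg_compl H K L (S : bop K L) (u : nat -> bop H K) (T : bop H K) :
  wot_cvg u T -> wot_cvg (fun n => bcomp S (u n)) (bcomp S T).
Proof.
move=> /wot_cvgP uT; apply/wot_cvgP => z w e e0.
have [N Ne] := uT z (adj S w) e e0; exists N => n /Ne.
by rewrite adjPr linearB.
Qed.

Lemma wot_cvg_compr H K L (S : bop H K) (u : nat -> bop K L) (T : bop K L) :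
  wot_cvg u T -> wot_cvg (fun n => bcomp (u n) S) (bcomp T S).
Proof. by move=> uT z w; exact: uT. Qed.

Lemma uniform_cvg_wot H K (u : nat -> bop H K) (T : bop H K) :
  (forall e : R, 0 < e -> exists N, forall n, (N <= n)%N ->
     forall z, nrm (u n z - T z) <= e * nrm z) -> wot_cvg u T.
Proof.
move=> uT; apply/wot_cvgP => z w e e0.
have k0 : 0 < nrm z * nrm w + 1 by rewrite ltr_wpDl // mulr_ge0 ?nrm_ge0.
have [|N Ne] := uT (e / (nrm z * nrm w + 1)); first by rewrite divr_gt0.
exists N => n /Ne /(_ z) unz; rewrite (le_lt_trans (cauchy_schwarz _ _)) //.
rewrite (le_lt_trans (ler_wpM2r (nrm_ge0 w) unz)) //.
by rewrite -[_ * _ * nrm w]mulrA mulrAC ltr_pdivrMr // ltr_pM2l // ltrDl.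
Qed.

End OperatorConvergence.

(** * Modules inside their interior tensor products *)

Section InteriorTensor.
Variables (R : realType) (H : hilbertType R) (B : set (bop H H)).
Variables (Y : premod H) (F : itensor B Y).
Implicit Types x y : Y.

Let F_ip x y z w : hip (F x z) (F y w) = hip z (pip x y w).
Proof. exact: itensor_ip. Qed.

(** With [pnorm_le], this says that the module norm of y is the operator norm of
    [F y], because [F y ^* F y] is the inner product of y with itself. *)
Lemma le_pnorm y z : nrm (F y z) <= pnorm y * nrm z.
Proof.
rewrite -(@ler_pXn2r _ 2) ?nnegrE ?mulr_ge0 ?sqrtr_ge0 ?nrm_ge0 //.
rewrite exprMn sqr_sqrtr ?opnorm_ge0 // nrm_sqE F_ip.
rewrite (le_trans (Re_hip_le _ _)) // mulrC expr2 mulrA ler_wpM2r ?nrm_ge0 //.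
exact: le_opnorm.
Qed.

Lemma pnorm_le y (M : R) : 0 <= M -> (forall z, nrm (F y z) <= M * nrm z) ->
  pnorm y <= M.
Proof.
move=> M0 yM; rewrite -(@ler_pXn2r _ 2) ?nnegrE ?sqrtr_ge0 //.
rewrite sqr_sqrtr ?opnorm_ge0 //; apply: opnorm_le => [|z]; first exact: sqr_ge0.
apply: le_nrm_hip => [|v]; first by rewrite mulr_ge0 ?sqr_ge0 ?nrm_ge0.
rewrite -F_ip (le_trans (cauchy_schwarz _ _)) //.
have := ler_pM (nrm_ge0 _) (nrm_ge0 _) (yM v) (yM z).
by move/le_trans; apply; rewrite mulrACA -expr2 (mulrC (nrm v)) mulrA.
Qed.

(** The triangle inequality, not apparent in terms of the inner product of the
    module, is inherited from the operator norm. *)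
Lemma pnorm_seminorm : seminorm (@pnorm R H Y).
Proof.
have le_scale a x : pnorm (a *: x) <= nrm a * pnorm x.
  apply: pnorm_le => [|z]; first by rewrite mulr_ge0 ?nrm_ge0 ?sqrtr_ge0.
  by rewrite linearZ bopZ nrmZ -mulrA ler_wpM2l ?nrm_ge0 ?le_pnorm.
split=> [x y|a x].
  apply: pnorm_le => [|z]; first by rewrite addr_ge0 ?sqrtr_ge0.
  by rewrite linearD bopD (le_trans (nrmD _ _)) // mulrDl lerD ?le_pnorm.
apply/eqP; rewrite eq_le le_scale /=.
have [->|a0] := eqVneq a 0; first by rewrite nrm0 mul0r sqrtr_ge0.
have := le_scale a^-1 (a *: x); rewrite scalerA mulVf // scale1r.
have a1 : nrm a * nrm a^-1 = 1.
  by rewrite -nrmM mulfV // /nrm normr1.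
by move/(ler_wpM2l (nrm_ge0 a)); rewrite mulrA a1 mul1r.
Qed.

Lemma itensor_inj : is_cstar_module B Y -> injective F.
Proof.
move=> Ym x y xy; apply/subr0_eq/(csm_ip_def Ym)/bop_ext => z.
apply: hip_inj => w; rewrite -F_ip linearB /= xy subrr.
by rewrite hip0l hip0r.
Qed.

Lemma pnorm_complete : is_cstar_module B Y -> complete_for (@pnorm R H Y).
Proof.
move=> Ym u /(csm_complete Ym)[x /cvgrPdistC_lt ux]; exists x => e /ux[N _ Ne].
by exists N => n /Ne /=; rewrite subr0 ger0_norm ?sqrtr_ge0.
Qed.

(** For fixed y the operators [<u n | y>] converge WOT and are therefore
    bounded.  Uniform boundedness on Y then bounds the coefficients
    [<F (u n) z, F y w>], for z and w in the unit ball, by [M |y|].  Taking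
    [y = u n] and w = z gives [|u n|^2 <= M |u n|]. *)
Lemma wotB_cvg_bounded u y : is_cstar_module B Y -> wotB_cvg u y ->
  exists M : R, forall n, pnorm (u n) <= M.
Proof.
move=> Ym uy.
pose coeff (c : nat * (H * H)) y := nrm (hip (F (u c.1) c.2.1) (F y c.2.2)).
pose A := [set coeff c | c in [set c | nrm c.2.1 <= 1 /\ nrm c.2.2 <= 1]].
have [_ [c _ <-]|_ [c _ <-]|x|M uM] := @uniform_boundedness R Y _ A
  pnorm_seminorm (pnorm_complete Ym).
- split=> [x x'|a x]; rewrite /coeff.
    by rewrite linearD bopD hipDr nrmD.
  by rewrite linearZ bopZ hipZr nrmM.
- exists (nrm (F (u c.1) c.2.1) * nrm c.2.2) => x; rewrite /coeff.
  rewrite (le_trans (cauchy_schwarz _ _)) // -mulrA ler_wpM2l ?nrm_ge0 //.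
  by rewrite mulrC le_pnorm.
- have [M M0 uM] := wot_cvg_bounded (uy x); exists M => _ [[n [z w]] /= [z1 w1] <-].
  rewrite /coeff /= F_ip (le_trans (cauchy_schwarz _ _)) //.
  have := uM n w; have := nrm_ge0 (pip (u n) x w).
  have := nrm_ge0 z; have := nrm_ge0 w; nra.
exists `|M| => n; have un0 : 0 <= pnorm (u n) := sqrtr_ge0 _.
have [u0|u0] := eqVneq (pnorm (u n)) 0; first by rewrite u0.
have up : 0 < pnorm (u n) by rewrite lt_neqAle eq_sym u0 un0.
rewrite -(ler_pM2r up) -expr2 sqr_sqrtr ?opnorm_ge0 //.
have M1 : 0 <= `|M| * pnorm (u n) by rewrite mulr_ge0.
have unit_ball z : nrm z <= 1 -> nrm (F (u n) z) ^+ 2 <= `|M| * pnorm (u n).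
  move=> z1; have Az : A (coeff (n, (z, z))) by exists (n, (z, z)).
  have := uM _ Az (u n); rewrite /coeff /= hip_nrm nrm_real ger0_norm ?sqr_ge0 //.
  by move/le_trans; apply; rewrite ler_wpM2r // ler_norm.
rewrite -(sqr_sqrtr M1) -[leLHS]sqr_sqrtr ?opnorm_ge0 // -/(pnorm _).
rewrite ler_pXn2r ?nnegrE ?sqrtr_ge0 //; apply: pnorm_le; first exact: sqrtr_ge0.
apply: bop_le_ball => z z1.
rewrite -(@ler_pXn2r _ 2) ?nnegrE ?sqrtr_ge0 ?nrm_ge0 //.
by rewrite (sqr_sqrtr M1) unit_ball.
Qed.

(** WOT_B convergence is convergence of the coefficients of [F (u n)] against
    the total set of vectors [F y w]; boundedness upgrades it to all of the
    interior tensor product. *)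
Lemma wotB_cvg_wot u y : is_cstar_module B Y -> wotB_cvg u y ->
  wot_cvg (fun n => F (u n)) (F y).
Proof.
move=> Ym uy; have [M uM] := wotB_cvg_bounded Ym uy.
apply/wot_cvgP => z; apply: (weak_cvg0_dense (M := (M + pnorm y) * nrm z)).
- move=> n; rewrite -nrmN opprB -bopB -linearB (le_trans (le_pnorm _ _)) //.
  rewrite ler_wpM2r ?nrm_ge0 // addrC.
  rewrite (le_trans (pnorm_seminorm.1 _ _)) // lerD ?seminormN //.
    exact: pnorm_seminorm.
- exact: itensor_dense.
move=> _ [x _ [w _ <-]] e e0.
have [N Ne] := (iffLR (wot_cvgP _ _)) (uy x) w z e e0.
exists N => n /Ne /=; rewrite !hipBl !F_ip -nrm_conj rmorphB /=.
by rewrite -!hip_conj.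
Qed.
End InteriorTensor.

(** * Existence of the completion *)

Section CompletionIsExtension.
Variables (R : realType) (H : hilbertType R) (B : set (bop H H)).
Variables (X : premod H) (E : itensor B X).
Local Notation K := (itensor_space E).
Local Notation BX := (completion E).

Lemma completion_ind (P : set (bop H K)) : wot_seq_closed P ->
  (forall x, P (E x)) -> forall T, completion_set T -> P T.
Proof. by move=> Pc PE T; apply; split=> // _ [x _ <-]. Qed.

Lemma completionP (T : BX) : completion_set (completion_op T).
Proof. by case: T => T /=; rewrite inE. Qed.

(** The T with [T b] in the completion form a WOT sequentially closed set,
    which contains E(X) because E is balanced. *)
Lemma completion_act_mem (T : bop H K) (b : bop H H) : B b ->
  completion_set T -> completion_set (bcomp T b).
Proof.
move=> Bb; apply: (@completion_ind [set S | completion_set (bcomp S b)]).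
  move=> u S uE uS; apply: (@completion_set_closed _ _ _ _ E _ _ uE).
  exact: wot_cvg_compr.
move=> x /=; apply: sub_completion_set; exists (pact x b) => //.
by apply: bop_ext => z; rewrite /= itensor_balanced.
Qed.

Lemma completion_actE (T : BX) (b : bop H H) : B b ->
  completion_op (pact T b) = bcomp (completion_op T) b.
Proof.
move=> Bb; apply: (insubdK (0 : completion_sort E)).
by rewrite !inE; apply: completion_act_mem Bb (completionP T).
Qed.

Lemma completion_opK (T : bop H K) : completion_set T ->
  exists T' : BX, completion_op T' = T.
Proof.
move=> ET; have mT : T \in @completion_pred _ _ _ _ E by rewrite !inE.
by exists (Completion mT).
Qed.

Lemma completion_op_inj : injective (@completion_op _ _ _ _ E).
Proof. exact: val_inj. Qed.

Lemma completion_opD (S T : BX) :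
  completion_op (S + T) = completion_op S + completion_op T.
Proof. by []. Qed.

Lemma completion_opZ a (T : BX) :
  completion_op (a *: T) = a *: completion_op T.
Proof. by []. Qed.

Lemma completion_op_eq0 (T : BX) : completion_op T = 0 -> T = 0.
Proof. by move=> T0; apply: completion_op_inj. Qed.

Lemma completion_op_linear : linear (@completion_op _ _ _ _ E).
Proof. by move=> a S T. Qed.

Lemma completion_ipE (S T : BX) z w :
  hip z (pip S T w) = hip (completion_op S z) (completion_op T w).
Proof. exact: hip_adj_comp. Qed.

(** One variable at a time: first S is replaced by elements of X, then T, where
    the operator is an inner product of X. *)
Lemma completion_ip_mem (S T : bop H K) : is_sigma_algebra B ->
  is_cstar_module B X -> completion_set S -> completion_set T ->
  B (bcomp (adj S) T).
Proof.
move=> [_ Bc] Xm ES ET; move: S ES.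
apply: (@completion_ind [set S | B (bcomp (adj S) T)]) => [u S uB uS|x] /=.
  apply: (Bc (fun n => bcomp (adj (u n)) T)) => //.
  by apply: wot_cvg_compr; exact: wot_cvg_adj.
move: T ET; apply: (@completion_ind [set T | B (bcomp (adj (E x)) T)]) => [u T uB uT|y] /=.
  by apply: (Bc (fun n => bcomp (adj (E x)) (u n))) => //; exact: wot_cvg_compl.
suff -> : bcomp (adj (E x)) (E y) = pip x y by exact: csm_ip Xm x y.
apply: bop_ext => w; apply: hip_inj => z.
by rewrite hip_adj_comp (itensor_ip E).
Qed.

(** The completion acts on H with values in K, and its simple tensors already
    span a dense subspace because those of X do: so K serves as the interior
    tensor product of the completion as well.  Transparent, since its
    operators have to be recognised as those of the completion. *)
Definition completion_itensor : itensor B BX.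
Proof.
pose f := GRing.isLinear.Build _ BX (bop H K) *:%R (@completion_op _ _ _ _ E)
  completion_op_linear.
pose F : {linear BX -> bop H K} := HB.pack (@completion_op _ _ _ _ E) f.
apply: (@ITensor _ _ _ _ K F) => [T b z Bb|S T z w|].
- by rewrite /= completion_actE.
- by rewrite /= -completion_ipE.
rewrite -subTset -(itensor_dense E); apply: closureS.
move=> _ [n [c [g [Gg ->]]]]; exists n, c, g; split=> // i.
have [x _ [z _ <-]] := Gg i.
by exists (completion_emb E x) => //; exists z.
Defined.

Lemma completion_wot_wotB (u : nat -> BX) (T : BX) :
  wot_cvg (fun n => completion_op (u n)) (completion_op T) -> wotB_cvg u T.
Proof. by move=> uT S; apply: wot_cvg_compr; exact: wot_cvg_adj. Qed.

Lemma completion_op_ip0 (T : BX) : pip T T = 0 -> T = 0.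
Proof.
move=> T0; apply: completion_op_eq0; apply: bop_ext => z.
apply/nrm_eq0/eqP; rewrite -sqrf_eq0 nrm_sqE -completion_ipE.
by rewrite T0 hip0r.
Qed.

(** A Cauchy sequence converges in operator norm, hence WOT, so its limit
    stays in the completion. *)
Lemma completion_complete (u : nat -> BX) :
  (forall e : R, 0 < e -> exists N : nat, forall m n : nat,
     (N <= m)%N -> (N <= n)%N -> pnorm (u m - u n) < e) ->
  exists T : BX, (fun n => pnorm (u n - T)) @ \oo --> (0 : R).
Proof.
move=> cu.
have [e e0|S uS] := @bop_complete R H K (fun n => completion_op (u n)).
  have [N Ne] := cu e e0; exists N => m n Nm Nn z.
  have := le_pnorm completion_itensor (u m - u n) z; move/le_trans; apply.
  by rewrite ler_wpM2r ?nrm_ge0 // ltW // Ne.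
have [|T TS] := @completion_opK S.
  apply: (@completion_set_closed _ _ _ _ E (fun n => completion_op (u n))).
    by move=> n; exact: completionP.
  exact: uniform_cvg_wot.
exists T; apply/cvgrPdistC_lt => e e0.
have [|N Ne] := uS (e / 2); first by rewrite divr_gt0.
exists N => // n /= Nn; rewrite subr0 ger0_norm ?sqrtr_ge0 //.
apply: (@le_lt_trans _ _ (e / 2)); last by lra.
apply: (@pnorm_le _ _ _ _ completion_itensor (u n - T) (e / 2)) => [|z].
  by rewrite divr_ge0 // ltW.
by move: (Ne n Nn z); rewrite -TS.
Qed.

Lemma completion_ip_linear a (S T T' : BX) :
  pip S (a *: T + T') = a *: pip S T + pip S T'.
Proof.
apply: bop_ext => z; apply: hip_inj => w.
rewrite completion_ipE completion_opD completion_opZ.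
by rewrite !(bopD, bopZ, hipDr, hipZr) !completion_ipE.
Qed.

Lemma completion_ip_act (S T : BX) (b : bop H H) : B b ->
  pip S (pact T b) = bcomp (pip S T) b.
Proof.
move=> Bb; apply: bop_ext => z; apply: hip_inj => w.
by rewrite completion_ipE completion_actE // -completion_ipE.
Qed.

Lemma completion_ip_adj (S T : BX) : pip T S = adj (pip S T).
Proof.
by apply: adj_unique => z w; rewrite hip_conj !completion_ipE -hip_conj.
Qed.

Lemma completion_cstar_module : is_sigma_algebra B -> is_cstar_module B X ->
  is_cstar_module B BX.
Proof.
move=> Bs Xm.
have BZ a b : B b -> B (a *: b).
  move=> Bb; rewrite -[a *: b]addr0.
  exact: (csa_lin Bs.1 a Bb (csa_0 Bs.1)).
have BD b c : B b -> B c -> B (b + c).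
  by move=> Bb Bc; rewrite -[b]scale1r; exact: (csa_lin Bs.1).
split.
- move=> S T b Bb; apply: completion_op_inj.
  by rewrite completion_opD !completion_actE // completion_opD bcompDl.
- move=> T b c Bb Bc; apply: completion_op_inj.
  by rewrite completion_opD !completion_actE ?bcompDr //; exact: BD.
- move=> T b c Bb Bc; apply: completion_op_inj.
  by rewrite !completion_actE ?bcompA //; exact: (csa_mul Bs.1).
- move=> a T b Bb; apply: completion_op_inj.
  by rewrite completion_opZ !completion_actE // completion_opZ bcompZl.
- move=> a T b Bb; apply: completion_op_inj.
  by rewrite completion_opZ !completion_actE ?bcompZr //; exact: BZ.
- by move=> S T; apply: completion_ip_mem => //; exact: completionP.
- exact: completion_ip_linear.
- exact: completion_ip_act.
- exact: completion_ip_adj.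
- by move=> T z; rewrite completion_ipE hip_ge0.
- exact: completion_op_ip0.
- exact: completion_complete.
Qed.

(** Density holds because WOT convergence in B(H, K) implies WOT_B
    convergence: a WOT_B sequentially closed set containing X therefore contains
    the WOT sequential closure of X. *)
Theorem completion_extension : is_sigma_algebra B -> is_cstar_module B X ->
  is_sigma_extension B (completion_emb E).
Proof.
move=> Bs Xm; split.
- split; first exact: completion_cstar_module.
  exists completion_itensor => u T uE uT.
  have [|T' T'T] := @completion_opK T; last by exists T'.
  apply: (@completion_set_closed _ _ _ _ E u) => // n.
  by have [S _ <-] := uE n; exact: completionP.
- split=> [a x y|x b Bb|x y].
  + by apply: completion_op_inj; rewrite /= linearP.
  + apply: completion_op_inj; rewrite completion_actE //=.
    by apply: bop_ext => z; rewrite /= itensor_balanced.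
  + apply: bop_ext => w; apply: hip_inj => z.
    by rewrite completion_ipE (itensor_ip E).
move=> D XD Dc; rewrite -subTset => T _.
suff [T' DT' /completion_op_inj <- //] :
    [set completion_op S | S in D] (completion_op T).
apply: (@completion_ind [set completion_op S | S in D]) (completionP T).
  move=> u S uD uS.
  have /choice[v vP] n : exists v, D v /\ completion_op v = u n.
    by have [v Dv <-] := uD n; exists v.
  have vu : u = fun n => completion_op (v n).
    by apply/funext => n; rewrite (vP n).2.
  have [|S' S'S] := @completion_opK S.
    apply: (@completion_set_closed _ _ _ _ E u) => // n.
    by rewrite vu; exact: completionP.
  exists S' => //; apply: Dc (fun n => (vP n).1) _.
  by apply: completion_wot_wotB; rewrite -vu S'S.
by move=> x; exists (completion_emb E x) => //; apply: XD; exists x.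
Qed.

End CompletionIsExtension.

(** * Extending isometries from total families *)

(** A family of vectors is determined up to isometry by its Gram matrix.  The
    isometry is the closure of the relation between finite combinations of the
    two families with equal coefficients. *)
Section IsometricExtension.
Variables (R : realType) (K L : hilbertType R) (I : Type).
Variables (e : I -> K) (f : I -> L).
Hypothesis same_gram : forall a b, hip (f a) (f b) = hip (e a) (e b).
Hypothesis e_total : closure (lspan (range e)) = setT.
Local Notation C := R[i].

(* Combinations are indexed by lists rather than by functions on ordinals, so
   that their inner products can be computed by induction. *)
Let comb (W : hilbertType R) (g : I -> W) (s : seq (C * I)) : W :=
  \sum_(p <- s) p.1 *: g p.2.

Let comb_nil (W : hilbertType R) (g : I -> W) : comb g [::] = 0.
Proof. exact: big_nil. Qed.

Let comb_cons (W : hilbertType R) (g : I -> W) p s :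
  comb g (p :: s) = p.1 *: g p.2 + comb g s.
Proof. exact: big_cons. Qed.

Let comb_gram s t : hip (comb f s) (comb f t) = hip (comb e s) (comb e t).
Proof.
elim: s => [|p s IH]; first by rewrite !comb_nil !hip0l.
rewrite !comb_cons !hipDl {}IH !hipZl; congr (_ * _ + _).
elim: t => [|q t IH]; first by rewrite !comb_nil !hip0r.
by rewrite !comb_cons !hipDr {}IH !hipZr same_gram.
Qed.

Let nrm_of_gram (W W' : hilbertType R) (u v : W) (u' v' : W') :
  hip u u = hip u' u' -> hip u v = hip u' v' -> hip v v = hip v' v' ->
  nrm (u - v) = nrm (u' - v').
Proof.
move=> uu uv vv; apply/eqP; rewrite -(@eqrXn2 _ 2) ?nrm_ge0 //; apply/eqP.
rewrite !nrm_sqE !(hipBl, hipBr) uu uv vv.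
by rewrite (hip_conj u v) (hip_conj u' v') uv.
Qed.

Let related (k : K) (l : L) := forall d : R, 0 < d ->
  exists s, nrm (k - comb e s) < d /\ nrm (l - comb f s) < d.

(* Approximating combinations of a given k form a Cauchy sequence, and so do the
   corresponding combinations of the other family. *)
Let related_total k : exists l, related k l.
Proof.
have /choice[s ks] n : exists s, nrm (k - comb e s) < n.+1%:R^-1.
  have : closure (lspan (range e)) k by rewrite e_total.
  move/closure_nrmP => /(_ n.+1%:R^-1) [|y [m [c [g [ge ->]]]] ky].
    by rewrite invr_gt0.
  have /choice[a ga] j : exists a, e a = g j by have [a _ ea] := ge j; exists a.
  exists [seq (c j, a j) | j <- enum 'I_m].
  rewrite /comb big_map big_enum /=; under eq_bigr do rewrite ga.
  exact: ky.
have [d d0|l sl] := @nrm_complete _ L (fun n => comb f (s n)).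
  have [|N Nd] := @natSinv_small R (d / 2); first by rewrite divr_gt0.
  exists N => m n Nm Nn.
  rewrite (nrm_of_gram (comb_gram _ _) (comb_gram _ _) (comb_gram _ _)).
  have := nrmB (comb e (s m)) k (comb e (s n)); rewrite (nrmBC _ k).
  have := ks m; have := ks n; have := Nd m Nm; have := Nd n Nn.
  by move: (m.+1%:R^-1) (n.+1%:R^-1) => x y; lra.
exists l => d d0; have [N1 N1d] := natSinv_small d0; have [N2 N2d] := sl d d0.
exists (s (maxn N1 N2)); split; last by rewrite nrmBC N2d // leq_maxr.
by rewrite (lt_trans (ks _)) // N1d // leq_maxl.
Qed.

Let hip_near (W : hilbertType R) (u v u' v' : W) (d : R) : d <= 1 ->
  nrm (u - u') < d -> nrm (v - v') < d ->
  nrm (hip u v - hip u' v') <= d * (nrm u + nrm v + 1).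
Proof.
move=> d1 uu' vv'.
have -> : hip u v - hip u' v' = hip (u - u') v + hip u' (v - v').
  by rewrite hipBl hipBr addrA subrK.
rewrite (le_trans (nrmD _ _)) //.
have := cauchy_schwarz (u - u') v; have := cauchy_schwarz u' (v - v').
have := nrmD (u' - u) u; rewrite subrK nrmBC.
have := nrm_ge0 u; have := nrm_ge0 v; have := nrm_ge0 u'.
have := nrm_ge0 (u - u'); have := nrm_ge0 (v - v').
move: (nrm (u - u')) (nrm (v - v')) uu' vv' => x y xd yd y0 x0 u'0 v0 u0 u'u h1 h2.
have p1 : x * nrm v <= d * nrm v by rewrite ler_wpM2r // ltW.
have p2 : nrm u' * y <= nrm u' * d by rewrite ler_wpM2l // ltW.
have p3 : nrm u' * d <= (nrm u + 1) * d by rewrite ler_wpM2r //; lra.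
by lra.
Qed.

Let related_hip k l k' l' : related k l -> related k' l' -> hip l l' = hip k k'.
Proof.
move=> kl kl'; apply/subr0_eq/nrm_eq0/eqP; rewrite eq_le nrm_ge0 andbT.
pose A := nrm l + nrm l' + nrm k + nrm k' + 2.
have A0 : 0 < A by rewrite ltr_wpDl // !addr_ge0 ?nrm_ge0.
apply/ler_addgt0Pr => d d0; rewrite add0r.
pose d' := Num.min 1 (d / A).
have d'0 : 0 < d' by rewrite lt_min ltr01 divr_gt0.
have d'1 : d' <= 1 by rewrite ge_min lexx.
have [s [ks ls]] := kl d' d'0; have [t [kt lt]] := kl' d' d'0.
have hl := hip_near d'1 ls lt; have hk := hip_near d'1 ks kt.
have := nrmB (hip l l') (hip (comb f s) (comb f t)) (hip k k').
rewrite {2}comb_gram (nrmBC (hip (comb e s) _)) => h.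
have : d' * A <= d by rewrite -ler_pdivlMr // ge_min lexx orbT.
rewrite /A; lra.
Qed.

(** The relation preserves inner products, and this alone makes it a linear
    function: [V (a u + v) - (a V u + V v)] has the same norm as
    [(a u + v) - (a u + v)]. *)
Theorem isometric_extension : exists V : bop K L,
  (forall a, V (e a) = f a) /\ (forall k k', hip (V k) (V k') = hip k k').
Proof.
have [V0 V0P] := choice related_total.
have V0_hip k k' : hip (V0 k) (V0 k') = hip k k' by apply: related_hip.
have lV0 : linear V0.
  move=> a u v; apply/subr0_eq/nrm_eq0/eqP; rewrite -sqrf_eq0 nrm_sqE.
  rewrite !(hipBl, hipBr, hipDl, hipDr, hipZl, hipZr, V0_hip).
  rewrite (_ : _ - _ = 0) //; ring.
have [|V VE] := @bop_of_bounded _ _ _ V0 1 lV0.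
  move=> z; rewrite mul1r -(@ler_pXn2r _ 2) ?nnegrE ?nrm_ge0 //.
  by rewrite !nrm_sqE V0_hip.
exists V; split=> [a|k k']; rewrite !VE //.
have eafa : related (e a) (f a).
  move=> d d0; exists [:: (1, a)].
  by rewrite !comb_cons !comb_nil !scale1r !addr0 !subrr !nrm0.
apply/subr0_eq/nrm_eq0.
rewrite (nrm_of_gram (u' := e a) (v' := e a)) ?subrr ?nrm0 //.
exact: related_hip.
Qed.

End IsometricExtension.

(** * Uniqueness of the completion *)

Section Uniqueness.
Variables (R : realType) (H : hilbertType R) (B : set (bop H H)).
Variables (X : premod H) (E : itensor B X).

Theorem completion_unique (Y : premod H) (i : X -> Y) : is_sigma_extension B i ->
  exists2 U : completion E -> Y, is_unitary_iso B U &
    forall x : X, U (completion_emb E x) = i x.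
Proof.
move=> [[Ym [F Fc]] [il iact iip] iX].
have [|| V [VE Vhip]] := @isometric_extension R (itensor_space E) (itensor_space F)
    (X * H) (fun p => E p.1 p.2) (fun p => F (i p.1) p.2).
- by move=> [x z] [y w] /=; rewrite !itensor_ip iip.
- rewrite -subTset -(itensor_dense E); apply: closureS.
  move=> _ [n [c [g [Gg ->]]]]; exists n, c, g; split=> // j.
  by have [x _ [z _ <-]] := Gg j; exists (x, z).
have VKV k : adj V (V k) = k.
  by apply: hip_inj => w; rewrite adjPr Vhip.
(* V E(X) = F(i(X)) lies in the WOT sequentially closed set F(Y), so V T lies
   there for every T in the closure of E(X). *)
have VF (T : completion E) : exists y, F y = bcomp V (completion_op T).
  suff [y _ yT] : range F (bcomp V (completion_op T)) by exists y.
  apply: (@completion_ind _ _ _ _ E [set T | range F (bcomp V T)]) (completionP T).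
    by move=> u S uF uS; apply: Fc uF _; exact: wot_cvg_compl.
  move=> x; exists (i x) => //; apply: bop_ext => z.
  exact: esym (VE (x, z)).
(* The y with F y in V times the completion contain i(X); they form a WOT_B
   sequentially closed set because F (u n) = V (T n) determines T n as
   V^* F (u n), which converges WOT. *)
have FV : [set y | exists T : completion E, F y = bcomp V (completion_op T)] = setT.
  apply: iX => [_ [x _ <-]|u y uD uy].
    exists (completion_emb E x); apply: bop_ext => z.
    exact: esym (VE (x, z)).
  have uF := wotB_cvg_wot (F := F) Ym uy.
  have /choice[T uT] := uD.
  have VuF := wot_cvg_compl (S := adj V) uF.
  have TE n : bcomp (adj V) (F (u n)) = completion_op (T n).
    by rewrite uT; apply: bop_ext => z; exact: VKV.
  have [|S SE] := @completion_opK _ _ _ _ E (bcomp (adj V) (F y)).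
    apply: (@completion_set_closed _ _ _ _ E (fun n => completion_op (T n))).
      by move=> n; exact: completionP.
    by under eq_fun do rewrite -TE.
  exists S; rewrite SE; apply: wot_cvg_unique uF _.
  have := wot_cvg_compl (S := V) VuF.
  by under eq_fun do rewrite TE -uT.
have [U UE] := choice VF.
have Finj := itensor_inj (F := F) Ym.
have UEz T z : F (U T) z = V (completion_op T z) by rewrite UE.
exists U; last first.
  move=> x; apply: Finj; apply: bop_ext => z; rewrite UEz.
  exact: (VE (x, z)).
split; last first.
  rewrite -subTset => y _.
  have [T yT] : [set y | exists T : completion E, F y = bcomp V (completion_op T)] y.
    by rewrite FV.
  by exists T => //; apply: Finj; rewrite UE.
split=> [a S T|T b Bb|S T].
- apply: Finj; apply: bop_ext => z.
  by rewrite linearP bopD bopZ !UEz -linearP.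
- apply: Finj; apply: bop_ext => z.
  by rewrite itensor_balanced // !UEz completion_actE.
- apply: bop_ext => w; apply: hip_inj => z.
  by rewrite -(itensor_ip F) !UEz Vhip completion_ipE.
Qed.

End Uniqueness.

Theorem proposition4p13 (R : realType) (H : hilbertType R)
  (B : set (bop H H)) (X : premod H) (E : itensor B X) :
  is_sigma_algebra B -> is_cstar_module B X -> countably_generated B X ->
  is_sigma_extension B (completion_emb E) /\
  forall (Y : premod H) (i : X -> Y), is_sigma_extension B i ->
    exists2 U : completion E -> Y, is_unitary_iso B U &
      forall x : X, U (completion_emb E x) = i x.
Proof.
move=> Bs Xm _; split; first exact: completion_extension.
by move=> Y i; exact: completion_unique.
Qed.
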